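(* Let $(p_m)_{m\ge 0}$ be a sequence of integers greater than $1$ and, for each $m\ge 0$, let $(s_{m,j})_{0\le j\le p_m-1}$ be real numbers with $s_{m,0}=0$ and $s_{m,j}>0$ for $1\le j\le p_m-1$. Let $h_m$ and the trigonometric polynomials $P_m$ be the associated objects defined in the context. Assume that there exists a sequence of positive integers $m_1<m_2<\cdots$ such that the numbers $$h_{m_j},\ s_{m_j,1},\ \dots,\ s_{m_j,p_{m_j}-1},\qquad j=1,2,\dots,$$ taken all together (over all $j$), are rationally independent. Then the generalized Riesz product $$\mu=\prod_{k=0}^{+\infty}|P_k(t)|^2$$ is singular with respect to the Haar measure on $b\mathbb{R}$.
   Context: $b\mathbb{R}$ is the Bohr compactification of $\mathbb{R}$: the compact abelian group containing $\mathbb{R}$ as a dense subgroup (via a continuous injective homomorphism) such that restriction to $\mathbb{R}$ is an isometric $\star$-isomorphism of $C(b\mathbb{R})$ onto the algebra of almost periodic functions on $\mathbb{R}$. An almost periodic function and its continuous extension to $b\mathbb{R}$ are denoted by the same letter; in particular each $t\mapsto e^{i\lambda t}$, $\lambda\in\mathbb{R}$, is regarded as a continuous character of $b\mathbb{R}$. The Haar measure on $b\mathbb{R}$, normalized to be a probability measure, is denoted by $h$. Measures on $b\mathbb{R}$ are regular Borel measures. Polynomials: put $\overline{s_{k,0}}=0$ and $\overline{s_{k,j}}=\sum_{l=0}^{j}s_{k,l}$ for $1\le j\le p_k-1$. Define $h_0=1$ and $h_{k+1}=p_kh_k+\overline{s_{k,p_k-1}}$ (the real numbers $h_k$ are not to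 be confused with the measure $h$). Then $$P_k(t)=\frac1{\sqrt{p_k}}\sum_{j=0}^{p_k-1}e^{it(jh_k+\overline{s_{k,j}})}.$$ The generalized Riesz product $\prod_{k=0}^{\infty}|P_k(t)|^2$ is the probability measure on $b\mathbb{R}$ which is the weak-$\star$ limit, as $n\to\infty$, of the probability measures $\prod_{k=0}^{n}|P_k(t)|^2\,dh(t)$ (this limit exists). A family of real numbers is rationally independent if every finite subfamily $\lambda_1,\dots,\lambda_r$ is linearly independent over $\mathbb{Z}$: for $n_1,\dots,n_r\in\mathbb{Z}$, $n_1\lambda_1+\cdots+n_r\lambda_r=0$ implies $n_1=\cdots=n_r=0$. *)

(* Defs.v *)
From HB Require Import structures.
From mathcomp Require Import all_boot all_order all_algebra.
From mathcomp Require Import all_classical all_reals all_analysis.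
From mathcomp Require Import complex.

Set Implicit Arguments.
Unset Strict Implicit.
Unset Printing Implicit Defensive.
Import Order.TTheory GRing.Theory Num.Theory.
Import numFieldNormedType.Exports.

Local Open Scope classical_set_scope.
Local Open Scope ring_scope.

(* The topology of R[i] is the one of its norm, as for any numFieldType. *)
HB.instance Definition _ (R : realType) := NormedModule.copy R[i] (R[i]^o)%type.

(* The library asks for a point in order to equip a type with a generated
   sigma-algebra; in a group we take the neutral element. *)
HB.instance Definition _ (K : topologicalZmodType) := isPointed.Build K 0.

Notation borel K := (g_sigma_algebraType (@open K)).

Section ComplexFunctions.
Variable R : realType.
Implicit Types (f : R -> R[i]).

Definition cmod (z : R[i]) : R := Normc.normc z.

Definition expi (x : R) : R[i] := (cos x +i* sin x)%C.

(* Almost periodicity in the sense of Bohr: for every e > 0 the e-almost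
   periods of f are relatively dense. *)
Definition almost_periodic f : Prop :=
  continuous f /\
  forall e : R, 0 < e -> exists2 L : R, 0 < L &
    forall a : R, exists2 tau : R, a <= tau <= a + L &
      forall t : R, cmod (f (t + tau) - f t) <= e.

Definition sup_norm (T : Type) (g : T -> R[i]) : R := sup (range (cmod \o g)).

End ComplexFunctions.

(* The group law of K is written additively. Restriction along iota is
   automatically a morphism of star-algebras, the operations being pointwise. *)
Record bohr_compactification (R : realType) (K : topologicalZmodType)
    (iota : R -> K) : Prop := BohrCompactification {
  bohr_compact : compact [set: K] ;
  bohr_hausdorff : hausdorff_space K ;
  bohr_morph : {morph iota : x y / x + y} ;
  bohr_continuous : continuous iota ;
  bohr_injective : injective iota ;
  bohr_dense : dense (range iota) ;
  bohr_isometric : forall g : K -> R[i], continuous g ->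
    sup_norm (g \o iota) = sup_norm g ;
  bohr_restriction :
    [set g \o iota | g in [set g : K -> R[i] | continuous g]] =
    [set f : R -> R[i] | almost_periodic f]
}.

(* The continuous extension to K of an almost periodic function f. It is unique
   when iota is a Bohr compactification; 0 is a junk value, used when there is
   no extension. *)
Definition bohr_ext (R : realType) (K : topologicalZmodType) (iota : R -> K)
    (f : R -> R[i]) : K -> R[i] :=
  xget (fun=> 0) [set g : K -> R[i] | continuous g /\ g \o iota = f].

Section Measures.
Variables (R : realType) (K : topologicalZmodType).
Local Open Scope ereal_scope.

Definition regular_measure (mu : {measure set (borel K) -> \bar R}) : Prop :=
  forall A : set (borel K), measurable A ->
    mu A = ereal_sup [set mu C | C in [set C : set K | compact C /\ C `<=` A]]
    /\
    mu A = ereal_inf [set mu U | U in [set U : set K | open U /\ A `<=` U]].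

Definition haar_probability (h : probability (borel K) R) : Prop :=
  regular_measure h /\
  forall (a : K) (A : set (borel K)), measurable A ->
    h [set (a + x)%R | x in A] = h A.

(* The measures (g n) dh converge weak-star to mu. *)
Definition weak_star_limit (h : {measure set (borel K) -> \bar R})
    (g : nat -> K -> R) (mu : {measure set (borel K) -> \bar R}) : Prop :=
  forall f : K -> R, continuous f ->
    ((\int[h]_x (f x * g n x))%R @[n --> \oo] --> (\int[mu]_x f x)%R).

Definition mutually_singular (mu nu : {measure set (borel K) -> \bar R}) :
    Prop :=
  exists2 A : set (borel K), measurable A & mu A = 0 /\ nu (~` A) = 0.

End Measures.

(* The integers p k are the cutting parameters and the reals s k j the spacers;
   only the values s k j with j < p k are used. *)
Section RieszProduct.
Variables (R : realType) (p : nat -> nat) (s : nat -> nat -> R).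

Definition spacer_sum (k j : nat) : R := \sum_(0 <= l < j.+1) s k l.

Fixpoint height (k : nat) : R :=
  if k is k'.+1 then (p k')%:R * height k' + spacer_sum k' (p k').-1 else 1.

Definition riesz_poly (k : nat) (t : R) : R[i] :=
  ((Num.sqrt (p k)%:R)^-1)%:C%C *
  \sum_(j < p k) expi (t * (j%:R * height k + spacer_sum k j)).

Variables (K : topologicalZmodType) (iota : R -> K).

Definition riesz_density (n : nat) (x : K) : R :=
  \prod_(0 <= k < n.+1) cmod (bohr_ext iota (riesz_poly k) x) ^+ 2.

Definition generalized_riesz_product (h mu : probability (borel K) R) : Prop :=
  regular_measure mu /\ weak_star_limit h riesz_density mu.

(* The numbers height (m j), s (m j) 1, ..., s (m j) (p (m j)).-1 for all j;
   the place (j, 0), free since s (m j) 0 = 0, holds height (m j). *)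
Definition height_spacer_family (m : nat -> nat)
    (x : {j : nat & 'I_(p (m j))}) : R :=
  if (tagged x : nat) == 0%N then height (m (tag x))
  else s (m (tag x)) (tagged x).

End RieszProduct.

Definition rationally_independent (R : realType) (I : eqType) (a : I -> R) :
    Prop :=
  forall (r : seq I) (n : I -> int), uniq r ->
    \sum_(i <- r) a i *~ n i = 0 -> forall i, i \in r -> n i = 0.

(* Main.v *)
(** Write [y_k = |P_k|^2].  The frequencies of [y_0 ... y_(k-1)] lie in the
    interval [(-h_k, h_k)], whereas the nonzero ones of [y_k] have modulus at
    least [h_k]; hence every finite subproduct of the [y_k] has Haar integral
    [1], and [\int F(q) dmu <= sup_(t >= 0) t F(t)] for every continuous
    [F >= 0] and every finite product [q] of distinct [y_k].

    Along the rationally independent subsequence, the frequencies of distinct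
    [P_(m_j)] generate subgroups of [R] in direct sum, so that the [y_(m_j)]
    behave as independent random variables on the Bohr compactification.  Each
    has mean [1], second moment at least [3/2] and third moment at most [6]
    (the last bound counts coincidences of sums of three frequencies, and uses
    independence inside one block).  As [sqrt y] is bounded by a cubic
    polynomial in [y] whose mean is therefore at most [127/128], the square
    root of [q_N = y_(m_0) ... y_(m_(N-1))] has mean at most [(127/128)^N].
    Thus [q_N] is small outside a set of small Haar measure, whereas
    [mu (q_N < d) = O(d)]: letting [N] tend to infinity and then [d] to [0],
    the Borel-Cantelli lemma yields a set separating [mu] from [h]. *)

Require Import Defs.
From mathcomp Require Import all_boot all_order all_algebra.
From mathcomp Require Import all_classical all_reals all_analysis.
From mathcomp Require Import complex zify ring lra.
Set Implicit Arguments.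
Unset Strict Implicit.
Unset Printing Implicit Defensive.
Import Order.TTheory GRing.Theory Num.Theory.
Import numFieldNormedType.Exports.
Local Open Scope classical_set_scope.
Local Open Scope ring_scope.

(** * Continuous functions and their integrals *)

Section ComplexContinuity.
Variable R : realType.
Implicit Types z : R[i].

Lemma cmod_sqrE z : cmod z ^+ 2 = complex.Re z ^+ 2 + complex.Im z ^+ 2.
Proof.
by case: z => a b; rewrite /cmod /= sqr_sqrtr // addr_ge0 // sqr_ge0.
Qed.

Lemma cmod_ge_Re z : `|complex.Re z| <= cmod z.
Proof.
case: z => a b /=; rewrite /cmod /= -sqrtr_sqr ler_wsqrtr // lerDl.
exact: sqr_ge0.
Qed.

Lemma cmod_ge_Im z : `|complex.Im z| <= cmod z.
Proof.
case: z => a b /=; rewrite /cmod /= -sqrtr_sqr ler_wsqrtr // lerDr.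
exact: sqr_ge0.
Qed.

Lemma cmod_le_ReIm z : cmod z <= `|complex.Re z| + `|complex.Im z|.
Proof.
have cz0 : 0 <= cmod z by case: z => a b; exact: sqrtr_ge0.
rewrite -(@ler_pXn2r _ 2) ?nnegrE ?addr_ge0 //.
rewrite cmod_sqrE sqrrD !real_normK ?num_real // lerD2r lerDl.
by rewrite mulrn_wge0 // mulr_ge0.
Qed.

Lemma continuous_complexP (T : topologicalType) (f : T -> R[i]) :
  continuous f <->
  continuous (fun x => complex.Re (f x)) /\
  continuous (fun x => complex.Im (f x)).
Proof.
split.
  move=> cf; split=> x; apply/cvgrPdist_lt => e e0;
    have /cvgrPdist_lt /(_ (e%:C)%C) := cf x;
    rewrite ltcR => /(_ e0); apply: filterS => y;
    rewrite ltcR => /(le_lt_trans _); apply; rewrite -raddfB.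
  - exact: cmod_ge_Re.
  - exact: cmod_ge_Im.
move=> [cR cI] x; apply/cvgrPdist_lt => e.
(* The radius [e] is itself a complex number: its positivity means zero imaginary part and positive
   real part. *)
rewrite ltcE => /= /andP[/eqP e_im e0].
have e20 : 0 < complex.Re e / 2 by rewrite divr_gt0.
move/cvgrPdist_lt : (cR x) => /(_ _ e20) nR.
move/cvgrPdist_lt : (cI x) => /(_ _ e20) nI.
near=> y.
rewrite ltcE /= e_im eqxx /=.
apply: le_lt_trans (cmod_le_ReIm _) _.
rewrite !raddfB /= (splitr (complex.Re e)) ltrD //.
  by near: y.
by near: y.
Unshelve. all: by end_near.
Qed.
End ComplexContinuity.

(** * Continuous functions against a probability on a compact group *)

Section ContinuousIntegration.
Variables (R : realType) (K : topologicalZmodType).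
Implicit Types f g : K -> R.

Lemma open_borel (U : set (borel K)) : open (U : set K) -> measurable U.
Proof. by move=> oU; exact: sub_sigma_algebra. Qed.

Lemma continuous_borel f :
  continuous f -> measurable_fun [set: borel K] (f : borel K -> R).
Proof.
move=> /continuousP cf.
apply: (measurability _ (measurable_realfun.RGenOpens.measurableE R)).
move=> _ [_ [a [b ->] <-]]; rewrite setTI; apply: open_borel.
exact/cf/interval_open.
Qed.

Hypothesis K_compact : compact [set: K].
Variable nu : probability (borel K) R.

(** Compactness bounds [f], and [nu] is finite. *)
Lemma continuous_integrable f :
  continuous f -> nu.-integrable [set: borel K] (EFin \o f).
Proof.
move=> cf; apply: measurable_bounded_integrable => //.
- by apply: le_lt_trans (ltry 1); exact: probability_le1.
- exact: continuous_borel.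
- have cfT : {within [set: K], continuous f} by exact: continuous_subspaceT.
  have /compact_bounded[M [_ f_le]] := continuous_compact
    (cfT : {within [set: K], continuous (f : K -> R^o)}) K_compact.
  exists M; split; rewrite ?num_real // => a Ma x _.
  by apply: f_le => //; exists x.
Qed.

Lemma Rintegral_continuousD f g : continuous f -> continuous g ->
  \int[nu]_x (f x + g x) = \int[nu]_x f x + \int[nu]_x g x.
Proof.
by move=> cf cg; apply: RintegralD => //; exact: continuous_integrable.
Qed.

Lemma Rintegral_continuousZ (c : R) f : continuous f ->
  \int[nu]_x (c * f x) = c * \int[nu]_x f x.
Proof.
by move=> cf; apply: RintegralZl => //; exact: continuous_integrable.
Qed.

Lemma Rintegral_probability_cst (c : R) : \int[nu]_x c = c.
Proof.
have nu1 := probability_setT nu.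
by rewrite Rintegral_cst // [X in fine X]nu1 mulr1.
Qed.

Lemma le_Rintegral_continuous f g : continuous f -> continuous g ->
  (forall x, f x <= g x) -> \int[nu]_x f x <= \int[nu]_x g x.
Proof.
by move=> cf cg fg; apply: le_Rintegral => //; exact: continuous_integrable.
Qed.

Lemma continuous_sum (I : Type) (r : seq I) (F : I -> K -> R) :
  (forall i, continuous (F i)) -> continuous (fun x => \sum_(i <- r) F i x).
Proof.
move=> cF; elim: r => [|i r IH].
  under eq_fun do rewrite big_nil; exact: cst_continuous.
under eq_fun do rewrite big_cons.
by move=> x; apply: cvgD; [exact: cF|exact: IH].
Qed.

Lemma continuous_prod (I : Type) (r : seq I) (P : pred I) (F : I -> K -> R) :
  (forall i, continuous (F i)) ->
  continuous (fun x => \prod_(i <- r | P i) F i x).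
Proof.
move=> cF; elim: r => [|i r IH].
  under eq_fun do rewrite big_nil; exact: cst_continuous.
under eq_fun do rewrite big_cons.
case: (P i) => // x; apply: cvgM; [exact: cF|exact: IH].
Qed.

Lemma Rintegral_continuous_sum (I : Type) (r : seq I) (F : I -> K -> R) :
  (forall i, continuous (F i)) ->
  \int[nu]_x (\sum_(i <- r) F i x) = \sum_(i <- r) \int[nu]_x F i x.
Proof.
move=> cF; elim: r => [|i r IH].
  rewrite big_nil; under eq_Rintegral do rewrite big_nil.
  exact: Rintegral_probability_cst.
rewrite big_cons -IH -Rintegral_continuousD //; last exact: continuous_sum.
by apply: eq_Rintegral => x _; rewrite big_cons.
Qed.

End ContinuousIntegration.

(** * Characters of the Bohr compactification *)

Section Exponential.
Variable R : realType.
Implicit Types x y l : R.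

Lemma expiD x y : expi (x + y) = expi x * expi y.
Proof.
rewrite /expi cosD sinD /GRing.mul /= /mulc.
by congr Complex; rewrite addrC // mulrC addrC [_ * cos y]mulrC.
Qed.

Lemma continuous_expi l : continuous (fun t : R => expi (t * l)).
Proof.
apply/continuous_complexP; split=> t /=;
  (apply: continuous_comp; first exact: mulrr_continuous).
- exact: continuous_cos.
- exact: continuous_sin.
Qed.

Lemma expi_2pi (n : int) : expi (pi *+ 2 *~ n) = 1 :> R[i].
Proof.
have nat_case k : expi (pi *+ 2 *+ k) = 1 :> R[i].
  rewrite -[_ *+ k]add0r /expi (periodicn (@cosD2pi R)) (periodicn (@sinD2pi R)).
  by rewrite cos0 sin0.
case: n => k; first exact: nat_case.
rewrite NegzE mulrNz; have := nat_case k.+1.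
rewrite /expi cosN sinN => -[-> ->].
by rewrite oppr0.
Qed.

Lemma cmod0 : cmod (0 : R[i]) = 0.
Proof. exact: Normc.normc0. Qed.

Lemma almost_periodic_expi l : almost_periodic (fun t : R => expi (t * l)).
Proof.
split=> [|e e0]; first exact: continuous_expi.
have [-> | l0] := eqVneq l 0.
  exists 1 => // a; exists a => [|t]; first by rewrite lexx lerDl ler01.
  by rewrite !mulr0 subrr cmod0 ltW.
have pi2 : 0 < pi *+ 2 :> R by rewrite mulrn_wgt0 // pi_gt0.
pose T := pi *+ 2 / `|l|.
have T0 : 0 < T by rewrite divr_gt0 // normr_gt0.
(* The exponential has period [T], and the least multiple of [T] above [a] lies in [[a, a + T]]. *)
exists T => // a; exists (T * (Num.ceil (a / T))%:~R) => [|t].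
  have := ceil_itv (a / T).
  rewrite ltr_pdivlMr // ler_pdivrMr // rmorphB /= mulrBl mul1r ltrBlDr.
  by rewrite ![T * _]mulrC => /andP[/ltW -> ->].
rewrite mulrDl expiD.
(* [T] is built from the modulus of [l], so the sign of [l] reappears in the integer multiple of
   [2 pi]. *)
suff -> : T * (Num.ceil (a / T))%:~R * l = pi *+ 2 *~ (sgz l * Num.ceil (a / T)).
  by rewrite expi_2pi mulr1 subrr cmod0 ltW.
rewrite -[RHS]mulrzr intrM -sgrEz [X in _ * X = _]numEsg /T.
have := l0; rewrite -normr_eq0 => l0'.
by field.
Qed.

End Exponential.

Section BohrCharacters.
Variables (R : realType) (K : topologicalZmodType) (iota : R -> K).
Hypothesis K_bohr : bohr_compactification iota.
Implicit Types (l : R) (x : K).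

(** The set where [f] and [g] differ is open and misses the dense range of [iota], hence is empty.
    The identities for [bcos] and [bchar] below are thereby reduced to trigonometry on the real
    line. *)
Lemma bohr_eq_real (f g : K -> R) : continuous f -> continuous g ->
  (forall t, f (iota t) = g (iota t)) -> f =1 g.
Proof.
move=> cf cg fg x; apply: contrapT => nfg.
have cfg : continuous (fun y => f y - g y).
  by move=> y; apply: cvgB; [exact: cf|exact: cg].
have oU : open [set y | f y - g y != 0].
  by move/continuousP : cfg => /(_ [set r | r != 0]); apply; exact: open_neq.
have [|y [/= + [t _ ty]]] := bohr_dense K_bohr _ oU.
  by exists x => /=; rewrite subr_eq0; apply/eqP.
by rewrite -ty fg subrr eqxx.
Qed.

Lemma bohr_eq (f g : K -> R[i]) : continuous f -> continuous g ->
  (forall t, f (iota t) = g (iota t)) -> f =1 g.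
Proof.
move=> /continuous_complexP[fR fI] /continuous_complexP[gR gI] fg x.
have := bohr_eq_real fR gR (fun t => congr1 (@complex.Re R) (fg t)) x.
have := bohr_eq_real fI gI (fun t => congr1 (@complex.Im R) (fg t)) x.
by case: (f x) (g x) => a b [c d] /= -> ->.
Qed.

(** Two continuous extensions agree on a dense set, so the choice made by [xget] is forced and the
    junk value does not occur. *)
Lemma bohr_extE (f : R -> R[i]) (g : K -> R[i]) :
  continuous g -> g \o iota = f -> bohr_ext iota f = g.
Proof.
move=> cg gf; rewrite /bohr_ext; case: xgetP => [k _ [ck kf]|/(_ g)]; last first.
  by case; split.
by apply/funext; apply: bohr_eq => // t; rewrite -[LHS]/((k \o iota) t) kf -gf.
Qed.

Definition bchar l : K -> R[i] := bohr_ext iota (fun t => expi (t * l)).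

Lemma bchar_continuous_iota l :
  continuous (bchar l) /\ forall t, bchar l (iota t) = expi (t * l).
Proof.
have [g cg gl] : [set g \o iota | g in [set g : K -> R[i] | continuous g]]
    (fun t : R => expi (t * l)).
  by rewrite (bohr_restriction K_bohr); exact: almost_periodic_expi.
rewrite /bchar (bohr_extE cg gl); split=> // t.
exact: (congr1 (fun f : R -> R[i] => f t) gl).
Qed.

Lemma continuous_bchar l : continuous (bchar l).
Proof. by have [] := bchar_continuous_iota l. Qed.

Lemma bchar_iota l t : bchar l (iota t) = expi (t * l).
Proof. by have [] := bchar_continuous_iota l. Qed.

Definition bcos l x : R := complex.Re (bchar l x).
Definition bsin l x : R := complex.Im (bchar l x).

Lemma continuous_bcos l : continuous (bcos l).
Proof. by have /continuous_complexP[] := @continuous_bchar l. Qed.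

Lemma continuous_bsin l : continuous (bsin l).
Proof. by have /continuous_complexP[] := @continuous_bchar l. Qed.

Lemma bcos_iota l t : bcos l (iota t) = cos (t * l).
Proof. by rewrite /bcos bchar_iota. Qed.

Lemma bsin_iota l t : bsin l (iota t) = sin (t * l).
Proof. by rewrite /bsin bchar_iota. Qed.

Lemma bcos0 x : bcos 0 x = 1.
Proof.
apply: (bohr_eq_real (f := bcos 0) (g := cst 1)) => //.
- exact: continuous_bcos.
- exact: cst_continuous.
- by move=> t; rewrite bcos_iota mulr0 cos0.
Qed.

Lemma bcosN l x : bcos (- l) x = bcos l x.
Proof.
apply: bohr_eq_real => [||t]; try exact: continuous_bcos.
by rewrite !bcos_iota mulrN cosN.
Qed.

Lemma bcosD l l' x :
  bcos (l + l') x = bcos l x * bcos l' x - bsin l x * bsin l' x.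
Proof.
apply: (bohr_eq_real (f := bcos (l + l'))
  (g := fun y => bcos l y * bcos l' y - bsin l y * bsin l' y)).
- exact: continuous_bcos.
- by move=> y; apply: cvgB; apply: cvgM;
    [exact: continuous_bcos|exact: continuous_bcos|
     exact: continuous_bsin|exact: continuous_bsin].
- by move=> t; rewrite !bcos_iota !bsin_iota mulrDr cosD.
Qed.

Lemma bcosB l l' x :
  bcos (l - l') x = bcos l x * bcos l' x + bsin l x * bsin l' x.
Proof.
have bsinN : bsin (- l') x = - bsin l' x.
  apply: (bohr_eq_real (f := bsin (- l')) (g := fun y => - bsin l' y)).
  - exact: continuous_bsin.
  - by move=> y; apply: cvgN; exact: continuous_bsin.
  - by move=> t; rewrite !bsin_iota mulrN sinN.
by rewrite bcosD bcosN bsinN mulrN opprK.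
Qed.

Lemma bcosM l l' x :
  bcos l x * bcos l' x = (bcos (l + l') x + bcos (l - l') x) / 2.
Proof. by rewrite bcosB bcosD; field. Qed.

Lemma bcharM l l' x : bchar l x * bchar l' x = bchar (l + l') x.
Proof.
apply: (bohr_eq (f := fun y => bchar l y * bchar l' y) (g := bchar (l + l'))).
- by move=> y; apply: cvgM; exact: continuous_bchar.
- exact: continuous_bchar.
- by move=> t; rewrite !bchar_iota mulrDr expiD.
Qed.

Lemma cmod_sum_bchar (J : finType) (theta : J -> R) x :
  cmod (\sum_i bchar (theta i) x) ^+ 2 =
  \sum_i \sum_j bcos (theta i - theta j) x.
Proof.
rewrite cmod_sqrE !raddf_sum /= !expr2 !big_distrlr -big_split /=.
apply: eq_bigr => i _; rewrite -big_split /=.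
by apply: eq_bigr => j _; rewrite bcosB.
Qed.

(** * Orthogonality of characters under the Haar measure *)

Section Haar.
Variable h : probability (borel K) R.
Hypothesis h_haar : haar_probability h.

(** Invariance is assumed for sets; a change of variables along the translation carries it over to
    integrals. *)
Lemma haar_translation (f : K -> R) (a : K) : continuous f ->
  \int[h]_x f (a + x) = \int[h]_x f x.
Proof.
move=> cf; have [_ h_inv] := h_haar.
have ca (b : K) : continuous (fun x : K => b + x).
  move=> x.
  apply: (@continuous_comp _ _ _ (pair b) (fun z : K * K => z.1 + z.2)).
    by apply: cvg_pair => /=; [exact: cvg_cst|exact: cvg_id].
  exact: add_continuous.
have ma : measurable_fun [set: borel K]
    ((fun x : K => a + x) : borel K -> borel K).
  refine (@measurability _ _ (borel K) (borel K) _ _ (@open K) erefl _).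
  move=> _ [U oU <-]; rewrite setTI; apply: open_borel.
  by move/continuousP : (ca a); exact.
have cfa : continuous (fun x => f (a + x)).
  by move=> x; apply: continuous_comp; [exact: ca|exact: cf].
rewrite /Rintegral.
have := @integral_pushforward _ _ _ _ R _ ma h setT (EFin \o f).
rewrite preimage_setT => /= <- //.
(* The preimage of [A] under [x => a + x] is the translate of [A] by [- a], so the pushforward of
   [h] is [h]. *)
- congr fine; apply: eq_measure_integral => A mA _.
  apply: etrans (h_inv (- a) A mA); congr (h _).
  apply/seteqP; split => [x /= Ax|x [y Ay <-]] /=.
    by exists (a + x) => //; rewrite addKr.
  by rewrite addrA subrr add0r.
- by apply/measurable_realfun.measurable_EFinP; exact: continuous_borel.
- exact: continuous_integrable (bohr_compact K_bohr) h _ cfa.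
Qed.

Lemma integral_bcos l : \int[h]_x bcos l x = (l == 0)%:R.
Proof.
have [-> | l0] := eqVneq l 0.
  by under eq_Rintegral do rewrite bcos0; exact: Rintegral_probability_cst.
(* Translation by [iota (pi / l)] changes the sign of [bcos l]. *)
have neg x : bcos l (iota (pi / l) + x) = -1 * bcos l x.
  apply: (bohr_eq_real (f := fun y => bcos l (iota (pi / l) + y))
    (g := fun y => -1 * bcos l y)).
  - move=> y; apply: continuous_comp; last exact: continuous_bcos.
    apply: (@continuous_comp _ _ _ (pair (iota (pi / l)))
      (fun z : K * K => z.1 + z.2)).
      by apply: cvg_pair => /=; [exact: cvg_cst|exact: cvg_id].
    exact: add_continuous.
  - by move=> y; apply: cvgM; [exact: cvg_cst|exact: continuous_bcos].
  - move=> t; rewrite -(bohr_morph K_bohr) !bcos_iota mulrDl divfK // addrC.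
    by rewrite cosDpi mulN1r.
have := haar_translation (iota (pi / l)) (@continuous_bcos l).
under eq_Rintegral do rewrite neg.
rewrite Rintegral_continuousZ //.
- by rewrite (_ : false%:R = 0) //; move: (Rintegral _ _ _) => I; lra.
- exact: bohr_compact K_bohr.
- exact: continuous_bcos.
Qed.

End Haar.
End BohrCharacters.

(** * Cosine polynomials *)

Section CosinePolynomials.
Variables (R : realType) (K : topologicalZmodType) (iota : R -> K).
Hypothesis K_bohr : bohr_compactification iota.
Variable h : probability (borel K) R.
Hypothesis h_haar : haar_probability h.
Implicit Types (f g : K -> R) (L : set R).
Local Notation bcos := (bcos iota).
Let K_compact := bohr_compact K_bohr.

(** The list of coefficient-frequency pairs may repeat frequencies or carry zero coefficients: only
    an upper bound [L] for the spectrum is tracked, which is all that orthogonality arguments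
    require. *)
Definition cospoly L f := exists2 l : seq (R * R),
  {in l, forall c, L c.2} & forall x, f x = \sum_(c <- l) c.1 * bcos c.2 x.

Lemma continuous_term (c : R) (a : R) : continuous (fun x => c * bcos a x).
Proof. by move=> x; apply: cvgM; [exact: cvg_cst|exact: continuous_bcos]. Qed.

Lemma cospoly_continuous L f : cospoly L f -> continuous f.
Proof.
move=> [l _ /funext ->]; apply: continuous_sum => c; exact: continuous_term.
Qed.

Lemma cospoly_sub L L' f : L `<=` L' -> cospoly L f -> cospoly L' f.
Proof. by move=> LL' [l lL fl]; exists l => // c /lL /LL'. Qed.

Lemma cospoly_bcos L a : L a -> cospoly L (bcos a).
Proof.
move=> La; exists [:: (1, a)] => [c|x]; first by rewrite inE => /eqP ->.
by rewrite big_seq1 mul1r.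
Qed.

Lemma cospolyD L f g : cospoly L f -> cospoly L g ->
  cospoly L (fun x => f x + g x).
Proof.
move=> [l lL fl] [l' lL' gl']; exists (l ++ l') => [c|x].
  by rewrite mem_cat => /orP[/lL|/lL'].
by rewrite big_cat fl gl'.
Qed.

Lemma cospolyZ L (c : R) f : cospoly L f -> cospoly L (fun x => c * f x).
Proof.
move=> [l lL fl]; exists [seq (c * d.1, d.2) | d <- l] => [e|x].
  by case/mapP => d dl ->; exact: (lL d dl).
by rewrite big_map fl mulr_sumr; apply: eq_bigr => d _; rewrite mulrA.
Qed.

Lemma cospoly_sum L (I : eqType) (r : seq I) (F : I -> K -> R) :
  (forall i, i \in r -> cospoly L (F i)) ->
  cospoly L (fun x => \sum_(i <- r) F i x).
Proof.
elim: r => [|i r IH] FL.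
  by exists [::] => // x; rewrite !big_nil.
under eq_fun do rewrite big_cons.
apply: cospolyD; first by apply: FL; rewrite mem_head.
by apply: IH => j jr; apply: FL; rewrite inE jr orbT.
Qed.

Lemma cospoly_const L (c : R) : L 0 -> cospoly L (cst c).
Proof.
move=> L0; have -> : cst c = fun x => c * bcos 0 x.
  by apply/funext => x; rewrite bcos0 // mulr1.
exact/cospolyZ/cospoly_bcos.
Qed.

Lemma integral_cospoly (l : seq (R * R)) :
  \int[h]_x (\sum_(c <- l) c.1 * bcos c.2 x) =
  \sum_(c <- l) c.1 * (c.2 == 0)%:R.
Proof.
rewrite Rintegral_continuous_sum //; last by move=> c; exact: continuous_term.
apply: eq_bigr => c _; rewrite Rintegral_continuousZ ?integral_bcos //.
exact: continuous_bcos.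
Qed.

Lemma mul_cospolyE (l l' : seq (R * R)) x :
  (\sum_(c <- l) c.1 * bcos c.2 x) * (\sum_(d <- l') d.1 * bcos d.2 x) =
  \sum_(e <- [seq (c.1 * d.1 / 2, c.2 + d.2) | c <- l, d <- l'] ++
             [seq (c.1 * d.1 / 2, c.2 - d.2) | c <- l, d <- l'])
     e.1 * bcos e.2 x.
Proof.
rewrite big_cat !big_allpairs_dep /= big_distrlr -big_split /=.
apply: eq_bigr => c _; rewrite -big_split; apply: eq_bigr => d _ /=.
by rewrite mulrACA bcosM //; field.
Qed.

Lemma cospolyM L L' L'' f g :
  (forall a b, L a -> L' b -> L'' (a + b) /\ L'' (a - b)) ->
  cospoly L f -> cospoly L' g -> cospoly L'' (fun x => f x * g x).
Proof.
move=> LL' [l lL fl] [l' lL' gl'].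
eexists => [e|x]; last by rewrite fl gl' mul_cospolyE.
rewrite mem_cat => /orP[] /allpairsP[[c d] /= [cl dl' ->]] /=;
  by have [] := LL' _ _ (lL _ cl) (lL' _ dl').
Qed.

(** The product of the cosines of frequencies [a] and [b] has nonzero mean only if [a = b] or
    [a = - b]. The hypothesis then forces both to vanish, so only the constant terms contribute to
    either side. *)
Lemma integral_cospolyM L L' f g :
  (forall a b, L a -> L' b -> a = b \/ a = - b -> a = 0) ->
  cospoly L f -> cospoly L' g ->
  \int[h]_x (f x * g x) = (\int[h]_x f x) * (\int[h]_x g x).
Proof.
move=> LL' [l lL /funext ->] [l' lL' /funext ->].
under eq_Rintegral do rewrite mul_cospolyE.
rewrite !integral_cospoly big_cat !big_allpairs_dep /= big_distrlr -big_split /=.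
apply: eq_big_seq => c cl; rewrite -big_split; apply: eq_big_seq => d dl' /=.
have H := LL' _ _ (lL _ cl) (lL' _ dl').
rewrite addr_eq0 subr_eq0.
have [c0|c0] := eqVneq c.2 0.
  by rewrite c0 ![0 == _]eq_sym oppr_eq0 /=; field.
have [cd|_] := eqVneq c.2 (- d.2).
  by move: c0; rewrite H ?eqxx //; right.
have [cd|_] := eqVneq c.2 d.2.
  by move: c0; rewrite H ?eqxx //; left.
by rewrite !mulr0 addr0 mul0r.
Qed.

Section Subgroup.
Variable L : set R.
Hypothesis L0 : L 0.
Hypothesis L_add : forall a b, L a -> L b -> L (a + b).
Hypothesis L_opp : forall a, L a -> L (- a).

Lemma cospoly_subgroupM f g : cospoly L f -> cospoly L g ->
  cospoly L (fun x => f x * g x).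
Proof.
apply: cospolyM => a b La Lb; split; first exact: L_add.
exact/L_add/L_opp.
Qed.

End Subgroup.

(** This turns the moments of the Riesz factors into counts of coincidences between frequencies. *)
Lemma integral_cmod_sum_bchar (J : finType) (theta : J -> R) :
  \int[h]_x (cmod (\sum_i bchar iota (theta i) x) ^+ 2) =
  \sum_i \sum_j (theta i == theta j)%:R.
Proof.
under eq_Rintegral do rewrite cmod_sum_bchar //.
rewrite Rintegral_continuous_sum //.
  apply: eq_bigr => i _; rewrite Rintegral_continuous_sum //.
    by apply: eq_bigr => j _; rewrite integral_bcos // subr_eq0.
  by move=> j; exact: continuous_bcos.
by move=> i; apply: continuous_sum => j; exact: continuous_bcos.
Qed.

End CosinePolynomials.

(** * Factors of the Riesz product *)

Section Frequencies.
Variables (R : realType) (p : nat -> nat) (s : nat -> nat -> R).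
Hypothesis p_gt1 : forall k, (1 < p k)%N.
Hypothesis s0 : forall k, s k 0%N = 0.
Hypothesis s_gt0 : forall k j, (1 <= j <= (p k).-1)%N -> 0 < s k j.
Local Notation height := (height p s).

Definition freq (k j : nat) : R := j%:R * height k + spacer_sum s k j.

Lemma freq0 k : freq k 0 = 0.
Proof. by rewrite /freq /spacer_sum big_nat1 s0 mul0r addr0. Qed.

Lemma freqS k j : freq k j.+1 = freq k j + height k + s k j.+1.
Proof. by rewrite /freq /spacer_sum big_nat_recr //= -natr1; ring. Qed.

Lemma heightS k : height k.+1 = freq k (p k).-1 + height k.
Proof.
by rewrite /freq /= -{1}(ltn_predK (p_gt1 k)) -natr1; ring.
Qed.

(** Each step from [j] to [j.+1] adds the height and a positive spacer. Positivity of the height is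
    an assumption here, because [height_gt0] is deduced from this lemma by induction on [k]. *)
Lemma freq_gap_aux k i j : 0 < height k -> (i < j <= (p k).-1)%N ->
  freq k i + height k <= freq k j.
Proof.
move=> hk; elim: j => // j IH /andP[].
have sj : (j.+1 <= (p k).-1)%N -> 0 < s k j.+1 by move=> jp; exact: s_gt0.
rewrite ltnS leq_eqVlt => /orP[/eqP -> /sj|ij jp]; rewrite freqS.
  by move=> sj0; lra.
have := IH; rewrite ij (ltnW jp) => /(_ isT).
by have := sj jp; lra.
Qed.

Lemma height_gt0 k : 0 < height k.
Proof.
elim: k => [|k IH]; first exact: ltr01.
rewrite heightS; suff : freq k 0 + height k <= freq k (p k).-1.
  by rewrite freq0; lra.
apply: freq_gap_aux => //.
by rewrite leqnn andbT -subn1 subn_gt0.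
Qed.

Lemma freq_gap k i j : (i < j <= (p k).-1)%N -> freq k i + height k <= freq k j.
Proof. exact/freq_gap_aux/height_gt0. Qed.

Lemma freq_bounds k j : (j <= (p k).-1)%N ->
  0 <= freq k j <= height k.+1 - height k.
Proof.
have hk := height_gt0 k; rewrite heightS addrK => jp; apply/andP; split.
  case: j jp => [|j jp]; first by rewrite freq0.
  by have := @freq_gap k 0 j.+1 jp; rewrite freq0; lra.
move: jp; rewrite leq_eqVlt => /orP[/eqP -> //|jp].
by have := @freq_gap k j (p k).-1; rewrite jp leqnn => /(_ isT); lra.
Qed.

(** The lower bound separates the spectrum of a factor from those of all earlier products; the upper
    bound keeps the new product below the next height. *)
Lemma freq_diff k (i j : 'I_(p k)) : i = j \/
  height k <= `|freq k i - freq k j| <= height k.+1 - height k.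
Proof.
have lep (l : 'I_(p k)) : (l <= (p k).-1)%N.
  by rewrite -ltnS (ltn_predK (p_gt1 k)).
have [/andP[i0 i1] /andP[j0 j1]] := (freq_bounds (lep i), freq_bounds (lep j)).
have hk := height_gt0 k.
case: (ltngtP i j) => [ij|ji|/val_inj]; [right|right|by left].
- have := @freq_gap k i j; rewrite ij lep => /(_ isT) gap.
  by rewrite ler0_norm; [apply/andP; split; lra|lra].
- have := @freq_gap k j i; rewrite ji lep => /(_ isT) gap.
  by rewrite ger0_norm; [apply/andP; split; lra|lra].
Qed.

Lemma freq_inj k : injective (fun j : 'I_(p k) => freq k j).
Proof.
move=> i j fij; case: (freq_diff i j) => // /andP[].
by rewrite fij subrr normr0 leNgt height_gt0.
Qed.

End Frequencies.

(** * The factors [|P_k|^2], their moments and their products *)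

Section RieszFactors.
Variables (R : realType) (K : topologicalZmodType) (iota : R -> K).
Hypothesis K_bohr : bohr_compactification iota.
Variable h : probability (borel K) R.
Hypothesis h_haar : haar_probability h.
Variables (p : nat -> nat) (s : nat -> nat -> R).
Hypothesis p_gt1 : forall k, (1 < p k)%N.
Hypothesis s0 : forall k, s k 0%N = 0.
Hypothesis s_gt0 : forall k j, (1 <= j <= (p k).-1)%N -> 0 < s k j.
Local Notation height := (height p s).
Local Notation freq := (freq p s).
Local Notation bcos := (bcos iota).
Local Notation bchar := (bchar iota).
Let K_compact := bohr_compact K_bohr.

Definition riesz_factor k x : R :=
  cmod (bohr_ext iota (riesz_poly p s k) x) ^+ 2.

Lemma p_neq0 k : (p k)%:R != 0 :> R.
Proof. by rewrite pnatr_eq0 -lt0n (ltn_trans _ (p_gt1 k)). Qed.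

Lemma riesz_factorE k x : riesz_factor k x =
  (p k)%:R^-1 * cmod (\sum_(j < p k) bchar (freq k j) x) ^+ 2.
Proof.
rewrite /riesz_factor; set c := ((Num.sqrt (p k)%:R)^-1)%:C%C : R[i].
rewrite (@bohr_extE _ _ _ K_bohr _
  (fun x => c * \sum_(j < p k) bchar (freq k j) x)).
- rewrite /cmod Normc.normcM exprMn; congr (_ * _).
  by rewrite /c /= expr0n addr0 sqrtr_sqr real_normK ?num_real // exprVn sqr_sqrtr.
- have cS : continuous (fun x => \sum_(j < p k) bchar (freq k j) x).
    apply/continuous_complexP; split.
      under eq_fun do rewrite raddf_sum.
      by apply: continuous_sum => j; exact: continuous_bcos.
    under eq_fun do rewrite raddf_sum.
    by apply: continuous_sum => j; exact: continuous_bsin.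
  by move=> y; apply: cvgM; [exact: cvg_cst|exact: cS].
- apply/funext => t /=; congr (_ * _); apply: eq_bigr => j _.
  by rewrite bchar_iota.
Qed.

Lemma riesz_factor_ge0 k x : 0 <= riesz_factor k x.
Proof. exact: sqr_ge0. Qed.

(** Moving the power inside the modulus writes it again as the squared modulus of a sum of
    characters, whose integral is a count. *)
Lemma riesz_factorXE k n x : riesz_factor k x ^+ n =
  (p k)%:R^-1 ^+ n * cmod ((\sum_(j < p k) bchar (freq k j) x) ^+ n) ^+ 2.
Proof.
rewrite riesz_factorE exprMn -!exprM mulnC exprM; congr (_ * _ ^+ _).
elim: n => [|n IH]; first by rewrite /cmod Normc.normc1.
by rewrite !exprS IH /cmod Normc.normcM.
Qed.

Lemma riesz_factor_bcos k x : riesz_factor k x =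
  (p k)%:R^-1 * \sum_(i < p k) \sum_(j < p k) bcos (freq k i - freq k j) x.
Proof. by rewrite riesz_factorE cmod_sum_bchar. Qed.

Lemma riesz_factor_cospoly (L : set R) k :
  (forall i j : 'I_(p k), L (freq k i - freq k j)) ->
  cospoly iota L (riesz_factor k).
Proof.
move=> Lk; rewrite (funext (riesz_factor_bcos k)).
apply: cospolyZ; apply: cospoly_sum => i _; apply: cospoly_sum => j _.
exact: cospoly_bcos.
Qed.

Lemma continuous_riesz_factor k : continuous (riesz_factor k).
Proof.
have /(cospoly_continuous K_bohr) : cospoly iota setT (riesz_factor k); last by [].
exact: riesz_factor_cospoly.
Qed.

(** Here [theta] enumerates the frequencies of the expanded [n]-th power, typically the sums over
    [n]-tuples of indices. *)
Lemma integral_riesz_factorX k n (J : finType) (theta : J -> R) :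
  (forall x, (\sum_(j < p k) bchar (freq k j) x) ^+ n =
     \sum_i bchar (theta i) x) ->
  \int[h]_x (riesz_factor k x ^+ n) =
  (p k)%:R^-1 ^+ n * \sum_i \sum_j (theta i == theta j)%:R.
Proof.
move=> thetaE; rewrite -(integral_cmod_sum_bchar K_bohr h_haar).
under eq_Rintegral do rewrite riesz_factorXE thetaE.
apply: Rintegral_continuousZ => //.
under eq_fun do rewrite cmod_sum_bchar //.
apply: continuous_sum => i; apply: continuous_sum => j; exact: continuous_bcos.
Qed.

Lemma integral_riesz_factor k : \int[h]_x riesz_factor k x = 1.
Proof.
have := @integral_riesz_factorX k 1 _
  (fun j : 'I_(p k) => freq k j) (fun=> erefl).
rewrite /= !expr1 => ->.
under eq_bigr => i _.
  rewrite (bigD1 i) //= eqxx big1 => [|j ji]; last first.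
    by case: eqP => // /(freq_inj p_gt1 s0 s_gt0) ij; rewrite ij eqxx in ji.
  over.
rewrite addr0 sumr_const card_ord.
by rewrite mulVf // p_neq0.
Qed.

Lemma riesz_factor_cospoly_gap k : cospoly iota
  [set a | a = 0 \/ height k <= `|a| <= height k.+1 - height k]
  (riesz_factor k).
Proof.
apply: riesz_factor_cospoly => i j /=.
case: (freq_diff p_gt1 s0 s_gt0 i j) => [->|]; [left; exact: subrr|by right].
Qed.

Definition riesz_subproduct (S : pred nat) n x : R :=
  \prod_(0 <= k < n | S k) riesz_factor k x.

Lemma riesz_subproductS (S : pred nat) n : riesz_subproduct S n.+1 =
  fun x => riesz_subproduct S n x * (if S n then riesz_factor n x else 1).
Proof.
apply/funext => x.
by rewrite /riesz_subproduct big_mkcond big_nat_recr //= -big_mkcond.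
Qed.

(** The two claims go through one induction. The product so far has frequencies below [height n] in
    modulus, while the nonzero ones of the new factor are at least [height n]: only the zero
    frequency is shared, and the means multiply. *)
Lemma riesz_subproduct_cospoly_integral (S : pred nat) n :
  cospoly iota [set a | `|a| < height n] (riesz_subproduct S n) /\
  \int[h]_x (riesz_subproduct S n x) = 1.
Proof.
have h_gt0 := height_gt0 p_gt1 s0 s_gt0.
elim: n => [|n [IHp IHi]].
  have -> : riesz_subproduct S 0 = cst 1.
    by apply/funext => x; rewrite /riesz_subproduct big_geq.
  split; last exact: Rintegral_probability_cst.
  by apply: cospoly_const => //=; rewrite normr0.
(* Since [p n] is at least 2, the last frequency of [P_n] is at least [height n]; adding [height n]
   gives [height n.+1]. *)
have hS : 2 * height n <= height n.+1.
  rewrite (heightS s p_gt1).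
  have := @freq_gap _ _ _ p_gt1 s0 s_gt0 n 0 (p n).-1.
  rewrite leqnn andbT -subn1 subn_gt0 p_gt1 => /(_ isT).
  by rewrite (freq0 p s0) subn1; lra.
rewrite riesz_subproductS; have := riesz_factor_cospoly_gap n; move: hS.
move: (height n.+1) => H hS gap.
case: (S n); last first.
  have -> : (fun x => riesz_subproduct S n x * 1) = riesz_subproduct S n.
    by apply/funext => x; rewrite mulr1.
  split=> //; apply: cospoly_sub IHp => a /= a_lt; apply: lt_le_trans a_lt _.
  by have := h_gt0 n; lra.
split.
  apply: cospolyM IHp gap => // a b /= a_lt [->|/andP[_ b_le]].
    by rewrite addr0 subr0; have := h_gt0 n; split; lra.
  split; [apply: le_lt_trans (ler_normD _ _) _|
          apply: le_lt_trans (ler_normB _ _) _]; lra.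
rewrite (integral_cospolyM K_bohr h_haar _ IHp gap).
  by rewrite IHi integral_riesz_factor mulr1.
move=> a b /= a_lt [->|/andP[b_ge _]]; first by rewrite oppr0; case.
by case=> ab; move: a_lt; rewrite ab ?normrN ltNge b_ge.
Qed.

End RieszFactors.

(** * Moments along the independent subsequence *)

Section SquareRootMajorant.
Variable R : realType.

(** The tangent to the square root at 1, lowered by a term of second order there. With first moment
    1, second at least 3/2 and third at most 6, the mean of [(y - 1)^2 (10 - y)] is at least 18 - 11
    - 6 = 1; the divisor 128 is large enough to stay above the square root. *)
Definition sqrt_majorant (y : R) : R :=
  (1 + y) / 2 - (y - 1) ^+ 2 * (10 - y) / 128.

Lemma sqrt_le_majorant y : 0 <= y -> Num.sqrt y <= sqrt_majorant y.
Proof.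
move=> y0; rewrite /sqrt_majorant -{2 3 4}(sqr_sqrtr y0).
move: (Num.sqrt y) (sqrtr_ge0 y) => x x0.
rewrite -subr_ge0.
have -> : (1 + x ^+ 2) / 2 - (x ^+ 2 - 1) ^+ 2 * (10 - x ^+ 2) / 128 - x =
  (x - 1) ^+ 2 * (64 - (x + 1) ^+ 2 * (10 - x ^+ 2)) / 128 by field.
apply: divr_ge0 => //; apply: mulr_ge0; first exact: sqr_ge0.
(* [(x + 1)^2 (10 - x^2) <= 2 (1 + x^2) (10 - x^2) <= 2 (11 / 2)^2 < 64] *)
have := sqr_ge0 (x - 1); have := sqr_ge0 (x ^+ 2 - 9 / 2).
have [x10|x10] := leP (10 : R) (x ^+ 2); last by nra.
have : 0 <= (x + 1) ^+ 2 * (x ^+ 2 - 10).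
  by rewrite mulr_ge0 ?sqr_ge0 // subr_ge0.
by lra.
Qed.

End SquareRootMajorant.

(** * Integer combinations of heights and spacers *)

Section SpacerSpan.
Variables (R : realType) (p : nat -> nat) (s : nat -> nat -> R).
Variable m : nat -> nat.
Hypothesis p_gt1 : forall k, (1 < p k)%N.
Hypothesis s0 : forall k, s k 0%N = 0.
Hypothesis indep : rationally_independent (@height_spacer_family R p s m).

(* As in [height_spacer_family], the index [l = 0] stands for the height. *)
Definition base (j l : nat) : R :=
  if l == 0%N then height p s (m j) else s (m j) l.

Definition combination (N : nat) (C : nat -> nat -> int) : R :=
  \sum_(0 <= j < N) \sum_(0 <= l < p (m j)) base j l *~ C j l.

(** Independence is applied to the list of all places in the first [N] blocks, so that later
    arguments can use coefficients indexed by plain natural numbers. *)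
Lemma combination_eq0 N C : combination N C = 0 ->
  forall j l, (j < N)%N -> (l < p (m j))%N -> C j l = 0.
Proof.
move=> C0 j l jN lp.
pose r := [seq Tagged (fun j => 'I_(p (m j))) i |
           j <- iota 0 N, i <- enum 'I_(p (m j))].
have := indep (r := r) (n := fun x => C (tag x) (tagged x)) _ _
  (i := Tagged (fun j => 'I_(p (m j))) (Ordinal lp)); apply.
- apply: allpairs_uniq_dep; first exact: iota_uniq.
    by move=> i _; exact: enum_uniq.
  move=> [a b] [c d] _ _ /= /eqP; rewrite -tag_eqE /tag_eq /=.
  by move=> /andP[/eqP ac]; case: _ / ac d => d; rewrite tagged_asE => /eqP ->.
- rewrite big_allpairs_dep -[RHS]C0 /combination /index_iota subn0.
  apply: eq_bigr => i _; rewrite big_enum /=.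
  rewrite -(big_mkord xpredT (fun l => base i l *~ C i l)).
  by rewrite /index_iota subn0.
- apply/allpairsPdep; exists j, (Ordinal lp); split=> //.
    by rewrite mem_iota.
  by rewrite mem_enum.
Qed.

(** The frequency of index [i] contains the height [i] times and each of the spacers 1 to [i]
    once. *)
Definition step_coef (i l : nat) : int :=
  if l == 0%N then Posz i else Posz (l <= i)%N.

Lemma freq_base j i : (i < p (m j))%N ->
  freq p s (m j) i = \sum_(0 <= l < p (m j)) base j l *~ step_coef i l.
Proof.
move=> ip; have p_gt0 : (0 < p (m j))%N by exact: ltnW (p_gt1 _).
rewrite /freq /spacer_sum big_ltn // [in RHS]big_ltn //.
rewrite s0 add0r /base /step_coef /= -pmulrn mulr_natl; congr (_ + _).
rewrite [RHS](big_cat_nat _ (n := i.+1)) //= [X in _ + X]big_nat_cond.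
rewrite [X in _ + X]big1 ?addr0 => [|l /andP[/andP[il _] _]]; last first.
  by case: l il => // l il; rewrite leqNgt il mulr0z.
by apply: eq_big_nat => l /andP[l0 li]; rewrite eqn0Ngt l0 /= -ltnS li.
Qed.

(** In the sum over [a], the coefficient of the spacer of index [l] is the number of entries of [a]
    that are at least [l]. Independence equates these numbers for [a] and [b], and consecutive
    differences recover the multiplicities. *)
Lemma freq_sum_inj j (a b : seq 'I_(p (m j))) : size a = size b ->
  \sum_(i <- a) freq p s (m j) i = \sum_(i <- b) freq p s (m j) i ->
  perm_eq a b.
Proof.
move=> ab.
have sumE (c : seq 'I_(p (m j))) : \sum_(i <- c) freq p s (m j) i =
    \sum_(0 <= l < p (m j)) base j l *~ (\sum_(i <- c) step_coef i l).
  under eq_bigr do rewrite freq_base //.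
  rewrite exchange_big; apply: eq_bigr => l _.
  by rewrite mulrz_sumr.
rewrite !sumE => /eqP; rewrite -subr_eq0 -sumrB => /eqP E0.
pose C j' l := if j' == j
  then \sum_(i <- a) step_coef i l - \sum_(i <- b) step_coef i l else 0.
have /combination_eq0 C0 : combination j.+1 C = 0.
  rewrite /combination big_nat_recr //= big_nat_cond big1; last first.
    move=> i /andP[/andP[_ ij] _].
    by rewrite big1 // => l _; rewrite /C (ltn_eqF ij) mulr0z.
  by rewrite add0r -[RHS]E0; apply: eq_bigr => l _; rewrite /C eqxx mulrzBr.
pose ge_pred l := fun i : 'I_(p (m j)) => (l <= i)%N.
have coefE (c : seq 'I_(p (m j))) l : l != 0%N ->
    \sum_(i <- c) step_coef i l = Posz (count (ge_pred l) c).
  move=> l0; elim: c => [|i c IH]; first by rewrite big_nil.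
  by rewrite big_cons IH /step_coef (negbTE l0).
have count_ge l : count (ge_pred l) a =
                  count (ge_pred l) b.
  (* At [l = 0] both counts are the common size; for [l] at least [p (m j)] both vanish, since no
     index is that large. *)
  have [->|l0] := eqVneq l 0%N; first by rewrite !count_predT.
  have [lp|pl] := ltnP l (p (m j)).
    have := C0 j l (ltnSn j) lp; rewrite /C eqxx !coefE // => /eqP.
    by rewrite subr_eq0 => /eqP[].
  by do 2 (rewrite (@eq_count _ _ pred0) ?count_pred0; last by
    move=> i /=; apply/negbTE; rewrite -ltnNge (leq_trans (ltn_ord i))).
have countE (c : seq 'I_(p (m j))) x : count_mem x c =
    (count (ge_pred x) c - count (ge_pred x.+1) c)%N.
  have -> : count (ge_pred x) c =
      (count_mem x c + count (ge_pred x.+1) c)%N.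
    rewrite /ge_pred; elim: c => // i c /= ->.
    have -> : ((x <= i) = (i == x) + (x < i) :> nat)%N.
      by rewrite -val_eqE /=; case: (ltngtP i x).
    by lia.
  by rewrite addnK.
by apply/allP => x _ /=; rewrite !countE !count_ge.
Qed.

Definition spacer_span (N : nat) (D : pred nat) : set R :=
  [set c | exists2 C, (forall j l, ~~ D j -> C j l = 0) & c = combination N C].

Lemma spacer_span0 N D : spacer_span N D 0.
Proof.
exists (fun _ _ => 0) => //; rewrite /combination big1 // => j _.
by rewrite big1 // => l _; rewrite mulr0z.
Qed.

Lemma spacer_spanB N D a b : spacer_span N D a -> spacer_span N D b ->
  spacer_span N D (a - b).
Proof.
move=> [C C0 ->] [C' C'0 ->]; exists (fun j l => C j l - C' j l).
  by move=> j l Dj; rewrite C0 // C'0 // subr0.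
rewrite /combination -sumrB; apply: eq_bigr => j _.
by rewrite -sumrB; apply: eq_bigr => l _; rewrite mulrzBr.
Qed.

Lemma spacer_spanN N D a : spacer_span N D a -> spacer_span N D (- a).
Proof. by rewrite -[- a]add0r; apply: spacer_spanB; exact: spacer_span0. Qed.

Lemma spacer_spanD N D a b : spacer_span N D a -> spacer_span N D b ->
  spacer_span N D (a + b).
Proof.
by move=> Da /spacer_spanN Db; rewrite -[b]opprK; exact: spacer_spanB.
Qed.

Lemma spacer_span_sub N D D' : subpred D D' ->
  spacer_span N D `<=` spacer_span N D'.
Proof.
move=> DD' _ [C C0 ->]; exists C => // j l D'j; apply: C0.
by apply: contra D'j; exact: DD'.
Qed.

(** The spans of disjoint sets of blocks are in direct sum: independence makes the two coefficient
    arrays of [a] equal, and on each block one of them is zero. *)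
Lemma spacer_span_disjoint N (D D' : pred nat) a : (forall j, D j -> ~~ D' j) ->
  spacer_span N D a -> spacer_span N D' a -> a = 0.
Proof.
move=> DD' [C C0 aC] [C' C'0 aC'].
have /combination_eq0 CC' : combination N (fun j l => C j l - C' j l) = 0.
  rewrite -(subrr a) {1}aC aC' /combination -sumrB; apply: eq_bigr => j _.
  by rewrite -sumrB; apply: eq_bigr => l _; rewrite mulrzBr.
rewrite aC /combination big_nat_cond big1 // => j /andP[/andP[_ jN] _].
rewrite big_nat_cond big1 // => l /andP[/andP[_ lp] _].
have [Dj|Dj] := boolP (D j); last by rewrite C0 // mulr0z.
by have := CC' j l jN lp; rewrite [C' _ _]C'0 ?DD' // subr0 => ->; rewrite mulr0z.
Qed.

Lemma spacer_span_freq N j (i : 'I_(p (m j))) : (j < N)%N ->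
  spacer_span N (pred1 j) (freq p s (m j) i).
Proof.
move=> jN; exists (fun j' l => if j' == j then step_coef i l else 0).
  by move=> j' l /negbTE /= ->.
rewrite /combination big_mkord (bigD1 (Ordinal jN)) //= [X in _ + X]big1.
  by rewrite addr0 freq_base //; apply: eq_bigr => l _; rewrite eqxx.
move=> j' /negbTE; rewrite -val_eqE /= => ->.
by rewrite big1 // => l _; rewrite mulr0z.
Qed.

End SpacerSpan.

(** The explicit list bounds by six the number of triples with a given multiset of entries,
    including when entries coincide. *)
Lemma mem_perm3 (T : eqType) (a1 a2 a3 b1 b2 b3 : T) :
  perm_eq [:: a1; a2; a3] [:: b1; b2; b3] ->
  (b1, b2, b3) \in [:: (a1, a2, a3); (a1, a3, a2); (a2, a1, a3);
                       (a2, a3, a1); (a3, a1, a2); (a3, a2, a1)].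
Proof.
have perm1 (x u : T) : perm_eq [:: x] [:: u] -> u = x.
  by move/perm_small_eq => /(_ isT) [->].
have perm2 (x y u v : T) : perm_eq [:: x; y] [:: u; v] ->
    u = x /\ v = y \/ u = y /\ v = x.
  move=> xy; have := perm_mem xy u; rewrite !inE eqxx /=.
  move=> /orP[] /eqP ux; move: xy; rewrite ux.
    by rewrite perm_cons => /perm1; left.
  by rewrite (perm_catC [:: x] [:: y]) perm_cons => /perm1; right.
move=> ab; have := perm_mem ab b1; rewrite !inE eqxx /= => /or3P[] /eqP b1E;
  move: ab; rewrite b1E.
- by rewrite perm_cons => /perm2[] [-> ->]; rewrite !eqxx ?orbT.
- rewrite (perm_catCA [:: a1] [:: a2] [:: a3]) perm_cons.
  by move=> /perm2[] [-> ->]; rewrite !eqxx ?orbT.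
- rewrite (perm_catC [:: a1; a2] [:: a3]) perm_cons.
  by move=> /perm2[] [-> ->]; rewrite !eqxx ?orbT.
Qed.

(** * Second and third moments, and the mean of the majorant *)

Section Moments.
Variables (R : realType) (K : topologicalZmodType) (iota : R -> K).
Hypothesis K_bohr : bohr_compactification iota.
Variable h : probability (borel K) R.
Hypothesis h_haar : haar_probability h.
Variables (p : nat -> nat) (s : nat -> nat -> R).
Variable m : nat -> nat.
Hypothesis p_gt1 : forall k, (1 < p k)%N.
Hypothesis s0 : forall k, s k 0%N = 0.
Hypothesis s_gt0 : forall k j, (1 <= j <= (p k).-1)%N -> 0 < s k j.
Hypothesis indep : rationally_independent (@height_spacer_family R p s m).
Local Notation freq := (freq p s).
Local Notation bchar := (bchar iota).
Local Notation riesz_factor := (riesz_factor iota p s).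
Let K_compact := bohr_compact K_bohr.

Lemma sqr_sum_bchar k x : (\sum_(j < p k) bchar (freq k j) x) ^+ 2 =
  \sum_(a : 'I_(p k) * 'I_(p k)) bchar (freq k a.1 + freq k a.2) x.
Proof.
rewrite expr2 big_distrlr pair_big /=; apply: eq_bigr => a _.
by rewrite bcharM.
Qed.

Lemma cube_sum_bchar k x : (\sum_(j < p k) bchar (freq k j) x) ^+ 3 =
  \sum_(a : 'I_(p k) * 'I_(p k) * 'I_(p k))
    bchar (freq k a.1.1 + freq k a.1.2 + freq k a.2) x.
Proof.
rewrite exprSr sqr_sum_bchar big_distrlr pair_big /=; apply: eq_bigr => a _.
by rewrite bcharM.
Qed.

(** A pair of distinct indices has the same frequency sum as its swap. This gives at least
    [2 p^2 - p] coincidences, hence a moment of at least [2 - 1 / p], and [p] is at least 2. *)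
Lemma riesz_factor_moment2 k : 3 / 2 <= \int[h]_x (riesz_factor k x ^+ 2).
Proof.
rewrite (integral_riesz_factorX K_bohr h_haar (sqr_sum_bchar k)).
set theta := fun a : 'I_(p k) * 'I_(p k) => freq k a.1 + freq k a.2.
have lower a : 1 + (a.1 != a.2)%:R <= \sum_b (theta a == theta b)%:R :> R.
  rewrite (bigD1 a) //= eqxx lerD2l.
  have [a12|a12] := eqVneq a.1 a.2; first by rewrite sumr_ge0.
  rewrite (bigD1 (a.2, a.1)) /=; last first.
    by apply: contraNneq a12; case: a => a b [->].
  by rewrite /theta /= [freq k a.1 + _]addrC eqxx lerDl sumr_ge0.
have : \sum_(a : 'I_(p k) * 'I_(p k)) (1 + (a.1 != a.2)%:R) <=
    \sum_a \sum_b (theta a == theta b)%:R :> R by apply: ler_sum.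
have -> : \sum_(a : 'I_(p k) * 'I_(p k)) (1 + (a.1 != a.2)%:R) =
    2 * (p k)%:R ^+ 2 - (p k)%:R :> R.
  have row i : \sum_(j < p k) (1 + (i != j)%:R) = 2 * (p k)%:R - 1 :> R.
    transitivity (\sum_(j < p k) (2 - (j == i)%:R) : R).
      by apply: eq_bigr => j _; rewrite eq_sym; case: eqP => _ /=; ring.
    rewrite sumrB sumr_const card_ord (bigD1 i) //= eqxx big1 ?addr0.
      by rewrite mulr_natr.
    by move=> j /negbTE ->.
  rewrite -(pair_big xpredT xpredT (fun i j => 1 + (i != j)%:R : R)) /=.
  under eq_bigr do rewrite row.
  by rewrite sumr_const card_ord -mulr_natr; ring.
set S := (X in _ <= X -> _) => S_ge.
change (3 / 2 <= (p k)%:R^-1 ^+ 2 * S).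
have p2 : 2 <= (p k)%:R :> R by rewrite ler_nat.
move: S S_ge; move: (p k)%:R p2 => q q2 S S_ge.
rewrite exprVn ler_pdivlMl ?exprn_gt0 //; last by lra.
have : 0 <= q * (q - 2) by rewrite mulr_ge0; lra.
by move: S_ge; rewrite !expr2; lra.
Qed.

(** By [freq_sum_inj], triples with equal frequency sums are rearrangements of each other. Each of
    the [p^3] triples thus has at most six partners. *)
Lemma riesz_factor_moment3 j : \int[h]_x (riesz_factor (m j) x ^+ 3) <= 6.
Proof.
set k := m j.
rewrite (integral_riesz_factorX K_bohr h_haar (cube_sum_bchar k)).
set theta := fun a : 'I_(p k) * 'I_(p k) * 'I_(p k) =>
  freq k a.1.1 + freq k a.1.2 + freq k a.2.
have upper a : \sum_b (theta a == theta b)%:R <= 6 :> R.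
  have -> : \sum_b (theta a == theta b)%:R =
      #|[pred b | theta a == theta b]|%:R :> R.
    rewrite -sum1_card natr_sum [RHS]big_mkcond; apply: eq_bigr => b _.
    by rewrite inE; case: (theta a == theta b).
  rewrite ler_nat; case: a => [[a1 a2] a3].
  apply: leq_trans (card_size [:: (a1, a2, a3); (a1, a3, a2); (a2, a1, a3);
                    (a2, a3, a1); (a3, a1, a2); (a3, a2, a1)]).
  apply: subset_leq_card; apply/fintype.subsetP => -[[b1 b2] b3].
  rewrite inE => /eqP ab.
  apply: mem_perm3; apply: (freq_sum_inj p_gt1 s0 indep) => //.
  rewrite !big_cons !big_nil !addr0 (addrA (freq _ a1)) (addrA (freq _ b1)).
  exact: ab.
have p_gt0 : 0 < (p k)%:R :> R by rewrite ltr0n ltnW.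
rewrite exprVn ler_pdivrMl ?exprn_gt0 //.
apply: le_trans (ler_sum _ (fun a _ => upper a)) _.
rewrite sumr_const !card_prod card_ord -[X in X <= _]mulr_natr !natrM.
by rewrite le_eqVlt; apply/orP; left; apply/eqP; ring.
Qed.

Local Notation majorant k := (fun x => sqrt_majorant (riesz_factor k x)).

Lemma majorantE (y : R) :
  sqrt_majorant y =
  54 / 128 + 85 / 128 * y + (- 12 / 128) * y ^+ 2 + 1 / 128 * y ^+ 3.
Proof. by rewrite /sqrt_majorant; field. Qed.

Lemma majorant_cospoly (L : set R) k : L 0 ->
  (forall a b, L a -> L b -> L (a + b)) -> (forall a, L a -> L (- a)) ->
  (forall i j : 'I_(p k), L (freq k i - freq k j)) ->
  cospoly iota L (majorant k).
Proof.
move=> L0 LD LN Lk.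
have Ly : cospoly iota L (riesz_factor k) by exact: riesz_factor_cospoly.
have LM f g := @cospoly_subgroupM _ _ _ K_bohr _ LD LN f g.
have Ly2 : cospoly iota L (fun x => riesz_factor k x ^+ 2).
  by under eq_fun do rewrite expr2; exact: LM.
have Ly3 : cospoly iota L (fun x => riesz_factor k x ^+ 3).
  by under eq_fun do rewrite exprS; exact: LM.
under eq_fun do rewrite majorantE.
apply: cospolyD; last exact: cospolyZ.
apply: cospolyD; last exact: cospolyZ.
apply: cospolyD; last exact: cospolyZ.
exact: cospoly_const.
Qed.

(** Only the second moment has a negative coefficient, so a lower bound is needed there and an upper
    one for the third: (54 + 85 - 18 + 6) / 128 = 127 / 128. *)
Lemma integral_majorant j : \int[h]_x majorant (m j) x <= 127 / 128.
Proof.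
set y := riesz_factor (m j).
have cX n : continuous (fun x => y x ^+ n).
  elim: n => [|n IH].
    by under eq_fun do rewrite expr0; exact: cst_continuous.
  under eq_fun do rewrite exprS.
  by move=> x; apply: cvgM; [exact: continuous_riesz_factor|exact: IH].
have cZ (c : R) n : continuous (fun x => c * y x ^+ n).
  by move=> x; apply: cvgM; [exact: cvg_cst|exact: cX].
have -> : \int[h]_x sqrt_majorant (y x) =
    \sum_(i < 4) [:: 54 / 128; 85 / 128; - 12 / 128; 1 / 128]`_i *
      \int[h]_x (y x ^+ i).
  under [RHS]eq_bigr do rewrite -Rintegral_continuousZ //.
  rewrite -Rintegral_continuous_sum //.
  apply: eq_Rintegral => x _; rewrite majorantE !big_ord_recl big_ord0 /=.
  by rewrite /bump /= expr0 expr1; ring.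
have m2 := riesz_factor_moment2 (m j); have m3 := riesz_factor_moment3 j.
have m1 : \int[h]_x (y x ^+ 1) = 1.
  by under eq_Rintegral do rewrite expr1; exact: integral_riesz_factor.
have m0 : \int[h]_x (y x ^+ 0) = 1.
  by under eq_Rintegral do rewrite expr0; exact: Rintegral_probability_cst.
rewrite !big_ord_recl big_ord0 /= /bump /= m0 m1.
by move: m2 m3; rewrite -/y; lra.
Qed.

(** [N] stays fixed during the induction on [n], so that all spans consist of combinations of the
    same [N] blocks. The spans of the blocks below [n] and of block [n] meet only in 0, whence the
    integrals multiply. *)
Lemma integral_majorant_prod N n : (n <= N)%N ->
  cospoly iota (spacer_span p s m N (fun j => j < n)%N)
    (fun x => \prod_(0 <= j < n) sqrt_majorant (riesz_factor (m j) x)) /\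
  \int[h]_x (\prod_(0 <= j < n) sqrt_majorant (riesz_factor (m j) x)) <=
    (127 / 128) ^+ n.
Proof.
(* Nonnegativity, needed to multiply the inequalities, comes from lying above a square root. *)
have G0 k x : 0 <= sqrt_majorant (riesz_factor k x).
  exact: le_trans (sqrtr_ge0 _) (sqrt_le_majorant (riesz_factor_ge0 _ _ _ _ _)).
elim: n => [|n IH] nN.
  have -> : (fun x => \prod_(0 <= j < 0) sqrt_majorant (riesz_factor (m j) x)) =
      cst 1.
    by apply/funext => x; rewrite big_geq.
  split; first by apply: cospoly_const => //; exact: spacer_span0.
  by rewrite Rintegral_probability_cst.
have [IHp IHi] := IH (ltnW nN).
have -> :
  (fun x => \prod_(0 <= j < n.+1) sqrt_majorant (riesz_factor (m j) x)) =
  (fun x => (\prod_(0 <= j < n) sqrt_majorant (riesz_factor (m j) x)) *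
            sqrt_majorant (riesz_factor (m n) x)).
  by apply/funext => x; rewrite big_nat_recr.
have Gn : cospoly iota (spacer_span p s m N (pred1 n)) (majorant (m n)).
  apply: majorant_cospoly.
  - exact: spacer_span0.
  - exact: spacer_spanD.
  - exact: spacer_spanN.
  - by move=> i i'; apply: spacer_spanB; apply: spacer_span_freq.
split.
  apply: (cospolyM K_bohr _ IHp Gn) => a b Da Db.
  have {}Da : spacer_span p s m N (fun j => j < n.+1)%N a.
    by apply: spacer_span_sub Da => j; exact: ltnW.
  have {}Db : spacer_span p s m N (fun j => j < n.+1)%N b.
    by apply: spacer_span_sub Db => j /eqP ->; exact: ltnSn.
  by split; [exact: spacer_spanD|exact: spacer_spanB].
rewrite (integral_cospolyM K_bohr h_haar _ IHp Gn).
  rewrite exprSr ler_pM //.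
  - by apply: Rintegral_ge0 => x _; apply: prodr_ge0.
  - by apply: Rintegral_ge0.
  - exact: integral_majorant.
have dis j : (j < n)%N -> ~~ pred1 n j by move=> /= jn; rewrite ltn_eqF.
move=> a b Da Db [ab|ab]; apply: (spacer_span_disjoint indep dis Da).
  by rewrite ab.
by rewrite ab; exact: spacer_spanN.
Qed.

End Moments.

(** * Singularity *)

Section Cutoff.
Variable R : realType.

(** A continuous substitute, on [y >= 0], for the indicator of [y < d]; weak-star convergence only
    tests continuous functions. *)
Definition cutoff (d y : R) : R := Num.max 0 (1 - y / d).

Lemma continuous_cutoff d : continuous (cutoff d).
Proof.
move=> y; rewrite /cutoff; under eq_fun do rewrite maxr_absE.
have lin : (1 - y / d) @[y --> y] --> 1 - y / d.
  by apply: cvgB; [exact: cvg_cst|apply: cvgM; [exact: cvg_id|exact: cvg_cst]].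
apply: cvgM; last exact: cvg_cst.
apply: cvgD; first by apply: cvgD; [exact: cvg_cst|exact: lin].
by apply: cvg_norm; apply: cvgB; [exact: cvg_cst|exact: lin].
Qed.

Lemma cutoff_ge0 d y : 0 <= cutoff d y.
Proof. by rewrite /cutoff le_max lexx. Qed.

Lemma cutoff_mul_le d y : 0 < d -> 0 <= y -> cutoff d y * y <= d.
Proof.
move=> d0 y0; rewrite /cutoff.
have [yd|dy] := leP (1 - y / d) 0; first by rewrite mul0r ltW.
have : y <= d by move: dy; rewrite subr_gt0 ltr_pdivrMr // mul1r => /ltW.
apply: le_trans; rewrite ler_piMl // lerBlDl lerDr.
by rewrite divr_ge0 // ltW.
Qed.

(** For [r = y / d], the left side is the minimum of 1 and [r], which is at most the square root of
    [r]. *)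
Lemma one_minus_cutoff_le d y : 0 < d -> 0 <= y ->
  1 - cutoff d y <= (Num.sqrt d)^-1 * Num.sqrt y.
Proof.
move=> d0 y0; have yd0 : 0 <= y / d by rewrite divr_ge0 // ltW.
have -> : (Num.sqrt d)^-1 * Num.sqrt y = Num.sqrt (y / d).
  by rewrite sqrtrM // sqrtrV ?ltW // mulrC.
rewrite /cutoff; move: (y / d) yd0 => r r0; rewrite -{1}(sqr_sqrtr r0).
move: (Num.sqrt r) (sqrtr_ge0 r) => x x0.
have [|] := leP (1 - x ^+ 2) 0; last by nra.
by move=> ?; rewrite subr0; nra.
Qed.

End Cutoff.

(** * A Borel-Cantelli criterion for mutual singularity *)

Section Singularity.
Variables (R : realType) (K : topologicalZmodType).

Lemma mutually_singularP (mu nu : probability (borel K) R) :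
  (forall e : R, 0 < e -> exists2 E : set (borel K), measurable E &
     (mu E <= e%:E)%E /\ (nu (~` E) <= e%:E)%E) ->
  mutually_singular mu nu.
Proof.
move=> small.
have e_gt0 n : 0 < 1 / (2 ^ n.+1)%:R :> R by rewrite divr_gt0 // ltr0n expn_gt0.
have /choice[E E_small] : forall n, exists E : set (borel K), measurable E /\
    (mu E <= (1 / (2 ^ n.+1)%:R)%:E)%E /\
    (nu (~` E) <= (1 / (2 ^ n.+1)%:R)%:E)%E.
  by move=> n; have [E mE [muE nuE]] := small _ (e_gt0 n); exists E.
have mE n : measurable (E n) by have [] := E_small n.
exists (lim_sup_set E); last split.
- by apply: bigcapT_measurable => n; apply: bigcup_measurable.
- apply: lim_sup_set_cvg0 => //.
  apply: (@le_lt_trans _ _ 1%:E); last exact: ltry.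
  apply: le_trans (epsilon_trick0 xpredT (ler01 : 0 <= 1 :> R)).
  by apply: lee_nneseries => // n _; have [_ []] := E_small n.
- rewrite /lim_sup_set setC_bigcap.
  apply/negligibleP.
    by apply: bigcupT_measurable => n; apply: measurableC;
      apply: bigcup_measurable.
  apply: negligible_bigcup => n; apply/negligibleP.
    by apply: measurableC; apply: bigcup_measurable.
  apply/eqP; rewrite eq_le measure_ge0 andbT.
  apply/lee_addgt0Pr => e e0; rewrite add0e.
  (* The index [maxn n k] is at least [n], so it belongs to the tail, and at least [k], so its
     tolerance is below [e]. *)
  have [k _ kP] := near_infty_natSinv_expn_lt (PosNum e0).
  have [nk kk] : (n <= maxn n k)%N /\ (k <= (maxn n k).+1)%N.
    by rewrite leq_maxl leqW // leq_maxr.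
  have [_ [_ nuE]] := E_small (maxn n k).
  apply: le_trans (le_trans _ nuE) _.
    apply: le_measure; rewrite ?inE; last first.
      by move=> x /=; apply: contra_not => Ex; exists (maxn n k).
    - exact: measurableC.
    - by apply: measurableC; apply: bigcup_measurable.
  by rewrite lee_fin natrX; apply/ltW/kP.
Qed.

Hypothesis K_compact : compact [set: K].

Lemma measurable_superlevel (F : K -> R) (c : R) : continuous F ->
  measurable ([set x | c <= F x] : set (borel K)).
Proof.
move=> cF; rewrite (_ : [set x | _] = ~` (F @^-1` [set r | r < c])).
  apply: measurableC; apply: open_borel.
  by move/continuousP : cF; apply; exact: open_lt.
apply/seteqP; split => x /= cFx; first by apply/negP; rewrite -leNgt.
by move/negP : cFx; rewrite -leNgt.
Qed.

(** Markov's inequality at level 1/2. *)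
Lemma measure_ge_half (nu : probability (borel K) R) (F : K -> R) :
  continuous F -> (forall x, 0 <= F x) ->
  (nu [set x | (1 / 2 <= F x)%R] <= (2 * \int[nu]_x F x)%:E)%E.
Proof.
move=> cF F0; set E := [set x | _].
have mE : measurable (E : set (borel K)) by exact: measurable_superlevel.
have mE_fin : nu E \is a fin_num by exact: fin_num_measure.
rewrite -(fineK mE_fin) lee_fin -[E in fine (nu E)]setIT -integral_indic //.
rewrite -/(Rintegral nu setT (\1_E)) -Rintegral_continuousZ //.
apply: le_Rintegral => //.
- exact: integrable_indic.
- apply: continuous_integrable => // x.
  by apply: cvgM; [exact: cvg_cst|exact: cF].
move=> x _; case: (boolP (x \in E)) => [|_] /=.
  by rewrite inE /E /=; lra.
by rewrite mulr_ge0.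
Qed.

End Singularity.

(** * Sets separating the Riesz product from the Haar measure *)

Section RieszProductSingularity.
Variables (R : realType) (K : topologicalZmodType) (iota : R -> K).
Hypothesis K_bohr : bohr_compactification iota.
Variables h mu : probability (borel K) R.
Hypothesis h_haar : haar_probability h.
Variables (p : nat -> nat) (s : nat -> nat -> R).
Variable m : nat -> nat.
Hypothesis p_gt1 : forall k, (1 < p k)%N.
Hypothesis s0 : forall k, s k 0%N = 0.
Hypothesis s_gt0 : forall k j, (1 <= j <= (p k).-1)%N -> 0 < s k j.
Hypothesis m_incr : forall j, (m j < m j.+1)%N.
Hypothesis indep : rationally_independent (@height_spacer_family R p s m).
Hypothesis mu_riesz : generalized_riesz_product p s iota h mu.
Local Notation riesz_factor := (riesz_factor iota p s).
Local Notation riesz_subproduct := (riesz_subproduct iota p s).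
Let K_compact := bohr_compact K_bohr.

Definition subsequence_product N x : R :=
  \prod_(0 <= j < N) riesz_factor (m j) x.

Lemma subsequence_product_ge0 N x : 0 <= subsequence_product N x.
Proof. by apply: prodr_ge0 => j _; exact: riesz_factor_ge0. Qed.

Lemma continuous_subsequence_product N : continuous (subsequence_product N).
Proof. by apply: continuous_prod => j; exact: continuous_riesz_factor. Qed.

Lemma continuous_cutoff_product d N :
  continuous (fun x => cutoff d (subsequence_product N x)).
Proof.
move=> x; apply: continuous_comp; first exact: continuous_subsequence_product.
exact: continuous_cutoff.
Qed.

(** As [m] is strictly increasing, [m 0], ..., [m N.-1] are distinct and lie below [m N], so all
    their factors occur in the density and can be pulled out. *)
Lemma riesz_density_split N n x : (m N <= n.+1)%N ->
  riesz_density p s iota n x =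
  subsequence_product N x *
  riesz_subproduct (fun k => k \notin map m (seq.iota 0 N)) n.+1 x.
Proof.
move=> mNn; have m_homo : {homo m : i j / (i < j)%N}.
  by apply: homo_ltn m_incr; exact: ltn_trans.
have m_inj : injective m by exact: incn_inj (leq_mono m_homo).
rewrite /riesz_density (bigID (fun k => k \in map m (seq.iota 0 N))) /=.
congr (_ * _).
rewrite -big_filter /subsequence_product /index_iota subn0.
rewrite -(big_map m xpredT (fun k => riesz_factor k x)).
apply: perm_big; apply: uniq_perm.
- by rewrite filter_uniq // iota_uniq.
- by rewrite map_inj_uniq // iota_uniq.
move=> k; rewrite mem_filter mem_iota add0n subn0 /=.
case: (boolP (k \in _)) => //= /mapP[j]; rewrite mem_iota /= add0n => jN ->.
by apply: leq_trans mNn; exact: m_homo.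
Qed.

(** The bound holds for every density of large index, uniformly, and passes to the weak-star
    limit. *)
Lemma integral_cutoff_mu d N : 0 < d ->
  \int[mu]_x cutoff d (subsequence_product N x) <= d.
Proof.
move=> d0; have [_ mu_lim] := mu_riesz.
have lim := mu_lim _ (@continuous_cutoff_product d N).
apply: (ler_cvg_to lim (cvg_cst d)).
near=> n.
have mNn : (m N <= n.+1)%N by apply: leqW; near: n; exact: nbhs_infty_ge.
set S := fun k => k \notin map m (seq.iota 0 N).
have [Sp Si] :=
  riesz_subproduct_cospoly_integral K_bohr h_haar p_gt1 s0 s_gt0 S n.+1.
have cS := cospoly_continuous K_bohr Sp.
(* The bound [d] is written as [d] times the Haar integral of the remaining subproduct; the
   integrands then compare pointwise by [cutoff_mul_le]. *)
rewrite -[leRHS]mulr1 -Si -Rintegral_continuousZ //.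
apply: le_Rintegral_continuous => //.
- move=> x; apply: cvgM; first exact: continuous_cutoff_product.
  rewrite (funext (fun y => riesz_density_split y mNn)).
  by apply: cvgM; [exact: continuous_subsequence_product|exact: cS].
- by move=> x; apply: cvgM; [exact: cvg_cst|exact: cS].
move=> x; rewrite (riesz_density_split _ mNn) mulrA ler_wpM2r //.
  by apply: prodr_ge0 => k _; exact: riesz_factor_ge0.
by apply: cutoff_mul_le => //; exact: subsequence_product_ge0.
Unshelve. all: by end_near.
Qed.

Lemma integral_cutoff_haar d N : 0 < d ->
  \int[h]_x (1 - cutoff d (subsequence_product N x)) <=
  (Num.sqrt d)^-1 * (127 / 128) ^+ N.
Proof.
move=> d0.
have [Gp Gi] :=
  integral_majorant_prod K_bohr h_haar p_gt1 s0 s_gt0 indep (leqnn N).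
have cG := cospoly_continuous K_bohr Gp.
have sd0 : 0 <= (Num.sqrt d)^-1 by rewrite invr_ge0 sqrtr_ge0.
apply: le_trans (ler_wpM2l sd0 Gi); rewrite -Rintegral_continuousZ //.
apply: le_Rintegral_continuous => //.
- by move=> x; apply: cvgB; [exact: cvg_cst|exact: continuous_cutoff_product].
- by move=> x; apply: cvgM; [exact: cvg_cst|exact: cG].
move=> x.
apply: le_trans (one_minus_cutoff_le d0 (subsequence_product_ge0 N x)) _.
apply: ler_wpM2l => //; rewrite /subsequence_product.
elim: N {Gp Gi cG} => [|N IH]; first by rewrite !big_geq // sqrtr1.
rewrite !big_nat_recr //= sqrtrM; last exact: subsequence_product_ge0.
by rewrite ler_pM ?sqrtr_ge0 // sqrt_le_majorant // riesz_factor_ge0.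
Qed.

Lemma riesz_product_singular : mutually_singular mu h.
Proof.
apply: mutually_singularP => e e0.
have d0 : 0 < e / 2 by rewrite divr_gt0.
(* Markov's inequality at level 1/2 costs a factor 2, which this choice absorbs for both
   measures. *)
set d := e / 2 in d0.
have sd0 : 0 < Num.sqrt d by rewrite sqrtr_gt0.
(* With [d] fixed first, [N] is taken so large that the Haar bound of [integral_cutoff_haar] is at
   most [d]. *)
have [N N_small] : exists N, (127 / 128) ^+ N <= d * Num.sqrt d :> R.
  have c1 : `|127 / 128 : R| < 1 by rewrite ger0_norm; lra.
  have /cvgr_le /(_ _ (mulr_gt0 d0 sd0)) [N _ NP] := cvg_expr c1.
  by exists N; apply: NP => /=.
pose F x := cutoff d (subsequence_product N x).
have cF : continuous F by exact: continuous_cutoff_product.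
have cF1 : continuous (fun x => 1 - F x).
  by move=> x; apply: cvgB; [exact: cvg_cst|exact: cF].
exists [set x | 1 / 2 <= F x].
  exact: measurable_superlevel.
split.
  apply: le_trans (measure_ge_half K_compact mu cF _) _.
    by move=> x; exact: cutoff_ge0.
  by rewrite lee_fin; have := integral_cutoff_mu N d0; rewrite -/(F _) /d; lra.
have sub : ~` [set x | 1 / 2 <= F x] `<=` [set x | 1 / 2 <= 1 - F x].
  by move=> x /= /negP; rewrite -ltNge; lra.
apply: (@le_trans _ _ (h [set x | 1 / 2 <= 1 - F x])).
  apply: le_measure; rewrite ?inE //; last exact: measurable_superlevel.
  by apply: measurableC; exact: measurable_superlevel.
apply: le_trans (measure_ge_half K_compact h cF1 _) _.
  move=> x; rewrite subr_ge0 /F /cutoff ge_max ler01 lerBlDr lerDl.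
  by rewrite divr_ge0 ?subsequence_product_ge0 // ltW.
rewrite lee_fin.
have := integral_cutoff_haar N d0.
have : (Num.sqrt d)^-1 * (127 / 128) ^+ N <= d.
  by rewrite ler_pdivrMl // [_ * d]mulrC.
by rewrite -/(F _) /d; lra.
Qed.

End RieszProductSingularity.

Theorem theorem3p2 (R : realType)
    (bR : topologicalZmodType) (iota : R -> bR)
    (bR_bohr : bohr_compactification iota)
    (h : probability (borel bR) R) (h_haar : haar_probability h)
    (p : nat -> nat) (p_gt1 : forall m, (1 < p m)%N)
    (s : nat -> nat -> R)
    (s0 : forall m, s m 0%N = 0)
    (s_gt0 : forall m j, (1 <= j <= (p m).-1)%N -> 0 < s m j)
    (m : nat -> nat)
    (m_gt0 : forall j, (0 < m j)%N)
    (m_incr : forall j, (m j < m j.+1)%N)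
    (indep : rationally_independent (@height_spacer_family R p s m))
    (mu : probability (borel bR) R)
    (mu_riesz : generalized_riesz_product p s iota h mu) :
  mutually_singular mu h.
Proof.
exact: (riesz_product_singular bR_bohr h_haar p_gt1 s0 s_gt0 m_incr).
Qed.
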